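(* Let $(\boldsymbol\mu_i,\gamma_i,\Sigma_i,\Psi_i)_{i\in[n]}$ be a network setting, and suppose that a stable point $(W,P)$ exists. Then there is no feasible $(W',P')$ that dominates $(W,P)$.
   Context: $[n]=\{1,\dots,n\}$; $\mathbf e_1,\dots,\mathbf e_n$ is the standard basis of $\mathbb R^n$. A network setting $(\boldsymbol\mu_i,\gamma_i,\Sigma_i,\Psi_i)_{i\in[n]}$ consists, for each agent $i\in[n]$, of a vector $\boldsymbol\mu_i\in\mathbb R^n$, a scalar $\gamma_i>0$, a symmetric positive definite matrix $\Sigma_i\in\mathbb R^{n\times n}$, and a constraint matrix $\Psi_i$ encoding an ordered set $J_i\subseteq[n]$ of agents with whom $i$ may form an edge (where $k\in J_i$ if and only if $i\in J_k$; $i\in J_i$ means the self-loop is permitted): $\Psi_i\in\{0,1\}^{|J_i|\times n}$ is obtained from $I_n$ by deleting the rows not indexed by $J_i$. A pair $(W,P)$ of real $n\times n$ matrices is feasible if $W=W^T$, $P=-P^T$, and $W_{ik}=P_{ik}=0$ whenever $k\notin J_i$. With $\mathbf w_i$ the $i$-th column of $W$, agent $i$'s utility is $g_i(W,P)=\mathbf w_i^T(\boldsymbol\mu_i-P\mathbf e_i)-\gamma_i\,\mathbf w_i^T\Sigma_i\mathbf w_i$. A feasible $(W,P)$ is a stable point if for every $i\in[n]$, $g_i(W,P)=\max g_i(W',P)$, the maximum being over all $W'$ such that $(W',P)$ is feasible. For feasible $(W_1,P_1)$ and $(W_2,P_2)$, $(W_2,P_2)$ dominates $(W_1,P_1)$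 if $g_i(W_1,P_1)\le g_i(W_2,P_2)$ for all $i\in[n]$, with at least one inequality strict. *)

(* Defs.v *)
From mathcomp Require Import all_boot all_order all_algebra.
From mathcomp Require Import classical_sets reals.

Set Implicit Arguments.
Unset Strict Implicit.
Unset Printing Implicit Defensive.

Import Order.TTheory GRing.Theory Num.Theory.
Local Open Scope classical_set_scope.
Local Open Scope ring_scope.

Definition posdefmx (R : realType) (n : nat) (S : 'M[R]_n) : Prop :=
  S^T = S /\ forall x : 'cV[R]_n, x != 0 -> 0 < (x^T *m S *m x) 0 0.

(* [enum_val] lists [J] in increasing order, so this is the identity matrix
   with the rows not indexed by [J] deleted. *)
Definition constraint_mx (R : realType) (n : nat) (J : {set 'I_n}) :
    'M[R]_(#|J|, n) :=
  rowsub (fun a : 'I_#|J| => enum_val a) 1%:M.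

(* Agents are indexed by ['I_n] = {0, ..., n-1} instead of {1, ..., n}. *)
Record network_setting (R : realType) (n : nat) := NetworkSetting {
  mu : 'I_n -> 'cV[R]_n;
  gamma : 'I_n -> R;
  Sigma : 'I_n -> 'M[R]_n;
  J : 'I_n -> {set 'I_n};
  Psi : forall i : 'I_n, 'M[R]_(#|J i|, n);
  gamma_gt0 : forall i, 0 < gamma i;
  Sigma_posdef : forall i, posdefmx (Sigma i);
  J_sym : forall i k, (k \in J i) = (i \in J k);
  PsiE : forall i, Psi i = constraint_mx R (J i) }.

Definition feasible (R : realType) (n : nat) (N : network_setting R n)
    (W P : 'M[R]_n) : Prop :=
  [/\ W = W^T, P = - P^T &
      forall i k, k \notin J N i -> W i k = 0 /\ P i k = 0].

Definition utility (R : realType) (n : nat) (N : network_setting R n)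
    (i : 'I_n) (W P : 'M[R]_n) : R :=
  let w := col i W in
  let e := delta_mx i 0 : 'cV[R]_n in
  (w^T *m (mu N i - P *m e)) 0 0
  - gamma N i * (w^T *m Sigma N i *m w) 0 0.

Definition is_maximum (R : realType) (A : set R) (x : R) : Prop :=
  A x /\ ubound A x.

Definition stable_point (R : realType) (n : nat) (N : network_setting R n)
    (W P : 'M[R]_n) : Prop :=
  feasible N W P /\
  forall i, is_maximum
    [set utility N i W' P | W' in [set W' | feasible N W' P]]
    (utility N i W P).

(* [(W2, P2)] dominates [(W1, P1)]; meant for feasible pairs only. *)
Definition dominates (R : realType) (n : nat) (N : network_setting R n)
    (W2 P2 W1 P1 : 'M[R]_n) : Prop :=
  (forall i, utility N i W1 P1 <= utility N i W2 P2) /\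
  (exists i, utility N i W1 P1 < utility N i W2 P2).

(* Main.v *)
(* Each agent's payment w_i^T P e_i is a diagonal entry of W^T P, and the trace
   of a symmetric times a skew-symmetric matrix vanishes, so the total utility
   does not depend on P. At a stable point (W, P) no agent gains by moving to
   (W', P), so the total utility at (W, P) is at least that at (W', P), which
   equals that at (W', P'); domination would make it strictly smaller. *)

Require Import Defs.
From mathcomp Require Import all_boot all_order all_algebra.
From mathcomp Require Import classical_sets reals.

Import Order.TTheory GRing.Theory Num.Theory.
Local Open Scope ring_scope.

(** Transposition and cyclicity of the trace turn [\tr (A *m B)] into its own opposite. *)
Lemma mxtrace_mul_sym_skew (R : numDomainType) (n : nat) (A B : 'M[R]_n) :
  A = A^T -> B = - B^T -> \tr (A *m B) = 0.
Proof.
move=> symA skewB; apply/eqP; rewrite -eqNr; apply/eqP.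
by rewrite -[in RHS]mxtrace_tr trmx_mul -symA [in RHS]mxtrace_mulC
  [in LHS]skewB mulmxN raddfN opprK.
Qed.

Lemma sum_utility_price_irrelevant (R : realType) (n : nat)
    (N : network_setting R n) (W P Q : 'M[R]_n) :
  W = W^T -> P = - P^T -> Q = - Q^T ->
  \sum_i utility N i W P = \sum_i utility N i W Q.
Proof.
move=> symW skewP skewQ.
(* Both sums are compared with the sum at zero prices. *)
suff sum0 (S : 'M[R]_n) : S = - S^T ->
    \sum_i utility N i W S = \sum_i utility N i W 0 by rewrite !sum0.
move=> skewS.
have utilityE i : utility N i W S = utility N i W 0 - (W *m S) i i.
  (* By symmetry, column [i] of [W] is also its row [i]. *)
  have -> : (W *m S) i i = ((col i W)^T *m col i S) 0 0.
    by rewrite tr_col -symW !mxE; apply: eq_bigr => k _; rewrite !mxE.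
  by rewrite /utility -colE mul0mx subr0 mulmxBr addrAC [in LHS]mxE
    [in X in _ + X - _]mxE.
rewrite (eq_bigr _ (fun i _ => utilityE i)) sumrB.
by rewrite -/(\tr (W *m S)) mxtrace_mul_sym_skew // subr0.
Qed.

Theorem theorem2 (R : realType) (n : nat) (N : network_setting R n)
    (W P : 'M[R]_n) (WP_stable : stable_point N W P) :
  ~ exists W' P' : 'M[R]_n, feasible N W' P' /\ dominates N W' P' W P.
Proof.
case: WP_stable => -[_ skewP offP] maxWP.
case=> W' [P' [[symW' skewP' offW'] [leWW' [j ltWW']]]].
(* Feasibility constrains the two matrices separately, so the mixed pair is an admissible deviation
   for every agent at once. *)
have feasW'P : feasible N W' P.
  by split=> // i k ik; split; [case: (offW' i k ik) | case: (offP i k ik)].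
have le_sum : \sum_i utility N i W' P <= \sum_i utility N i W P.
  by apply: ler_sum => i _; case: (maxWP i) => _; apply; exists W'.
have : \sum_i utility N i W P < \sum_i utility N i W' P'.
  by rewrite (bigD1 j) //= [ltRHS](bigD1 j) //= ltr_leD // ler_sum.
by rewrite (sum_utility_price_irrelevant _ _ _ _ _ P symW' skewP' skewP) ltNge
  le_sum.
Qed.
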